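(* Let $a,b,h,a'',b''$ be smooth functions of $(u,v)$ on an open set $D\subset\mathbb{R}^2$, with $h$ nowhere zero, satisfying the integrability conditions $$ah=h_u,\quad a_v=ba''+h,\quad b_v+bb''=0,\quad h_v=b''h,\quad a''_u+aa''=0,\quad h=b''_u+a''b.$$ Consider, for the unknown functions $x,y,z$ of $(u,v)$, the PDE system $$\theta_{uu}=a\theta_u+b\theta_v,\qquad \theta_{uv}=h\theta,\qquad \theta_{vv}=a''\theta_u+b''\theta_v\qquad (\theta\in\{x,y,z\}).$$ Let $G$ be the full symmetry group of this system and let $G_2$ be the subgroup of $G$ which acts on the space of the independent variables (that is, whose infinitesimal generators have the form $\zeta(u,v)\frac{\partial}{\partial u}+\eta(u,v)\frac{\partial}{\partial v}$). Then the general vector field of the algebra of infinitesimal symmetries associated to $G_2$ is $$Z=\zeta(u)\frac{\partial}{\partial u}+\eta(v)\frac{\partial}{\partial v},$$ where the functions $\zeta=\zeta(u)$ and $\eta=\eta(v)$ satisfy the PDE system $$\begin{aligned}&\zeta a_u+\eta a_v+a\zeta_u+\zeta_{uu}=0,\\ &\zeta b_u+\eta b_v-b\eta_v+2b\zeta_u=0,\\ &\zeta h_u+\eta h_v+h(\zeta_u+\eta_v)=0,\\ &\zeta a''_u+\eta a''_v-a''\zeta_u+2a''\eta_v=0,\\ &\zeta b''_u+\eta b''_v+b''\eta_v+\eta_{vv}=0.\end{aligned}$$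
   Context: The functions $a,b,h,a'',b''$ are five independent names (the double prime is not a derivative); subscripts $u,v$ denote partial derivatives. Symmetry groups: a symmetry group of a PDE system $\Delta_\nu(x,u^{(n)})=0$, $\nu=1,\dots,l$, in independent variables $x=(x^1,\dots,x^p)$ and dependent variables $u=(u^1,\dots,u^q)$ ($u^{(n)}$ denotes all derivatives of orders $0$ to $n$) is a local group of transformations acting on an open subset $M$ of the space of independent and dependent variables that transforms solutions into solutions. Its Lie algebra of infinitesimal generators (infinitesimal symmetries) is determined by the infinitesimal invariance condition: a vector field $X=\sum_i\zeta^i(x,u)\frac{\partial}{\partial x^i}+\sum_\alpha\phi_\alpha(x,u)\frac{\partial}{\partial u^\alpha}$ is an infinitesimal symmetry if $\mathrm{pr}^{(n)}X[\Delta_\nu(x,u^{(n)})]=0$ for all $\nu$ whenever $\Delta(x,u^{(n)})=0$, where $\mathrm{pr}^{(n)}X=X+\sum_\alpha\sum_J\phi_\alpha^J\frac{\partial}{\partial u^\alpha_J}$, the sum being over multi-indices of order $1\le |J|\le n$, and $\phi^J_\alpha=D_J\big(\phi_\alpha-\sum_i\zeta^iu^\alpha_i\big)+\sum_i\zeta^iu^\alpha_{J,i}$ with $D_J$ the total derivative. The full symmetry group is the one generated by all infinitesimal symmetries. *)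

(* Defs.v *)
From mathcomp Require Import all_boot all_order all_algebra.
From mathcomp Require Import all_classical all_reals all_analysis.
Import Order.TTheory GRing.Theory Num.Theory.
Import numFieldNormedType.Exports.

Set Implicit Arguments.
Unset Strict Implicit.
Unset Printing Implicit Defensive.

Local Open Scope classical_set_scope.
Local Open Scope ring_scope.

(* C^k and C^oo on an open set U of a finite-dimensional space: every iterated
   directional derivative of order at most k exists and is continuous on U.
   Values of f outside U are irrelevant. *)
Fixpoint Ck {R : realType} {V : normedModType R} (k : nat) (U : set V)
    (f : V -> R) : Prop :=
  (forall x, U x -> {for x, continuous f}) /\
  (if k is k'.+1 then
     forall v : V, (forall x, U x -> derivable f x v) /\ Ck k' U ('D_v f)
   else True).

Definition smooth {R : realType} {V : normedModType R} (U : set V)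
  (f : V -> R) : Prop := forall k, Ck k U f.

Definition du {R : realType} (f : R * R -> R) : R * R -> R :=
  'D_((1, 0) : R * R) f.
Definition dv {R : realType} (f : R * R -> R) : R * R -> R :=
  'D_((0, 1) : R * R) f.

(* For a general open D, "f depends on u alone" means that f is constant on
   every vertical segment contained in D. When the vertical slices of D are
   intervals (e.g. D a rectangle), this says f (u, v) = f0 u on D. *)
Definition function_of_u {R : realType} (D : set (R * R)) (f : R * R -> R) :
    Prop :=
  forall u v v' : R, v <= v' -> (forall t, v <= t <= v' -> D (u, t)) ->
    f (u, v) = f (u, v').
Definition function_of_v {R : realType} (D : set (R * R)) (f : R * R -> R) :
    Prop :=
  forall u u' v : R, u <= u' -> (forall t, u <= t <= u' -> D (t, v)) ->
    f (u, v) = f (u', v).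

(* The space of independent variables (u, v) and dependent variables
   (x, y, z); the latter are the three entries of a row vector. *)
Definition space (R : realType) := (R * R * 'rV[R]_3)%type.

(* xi d/du + eta d/dv + \sum_al phi_al d/du^al *)
Record vfield (R : realType) := VField {
  vf_u : space R -> R;
  vf_v : space R -> R;
  vf_dep : 'I_3 -> space R -> R }.

Definition smooth_vfield {R : realType} (M : set (space R)) (X : vfield R) :
    Prop :=
  [/\ smooth M (vf_u X), smooth M (vf_v X) & forall al, smooth M (vf_dep X al)].

(* Coordinates on the infinite jet space: u, v, and the derivative
   u^al_(j,k) = d^(j+k) u^al / du^j dv^k; u^al itself is (j, k) = (0, 0).
   Only finitely many coordinates occur in each function considered below. *)
Definition jcoord : eqType := (bool + 'I_3 * (nat * nat))%type.
Definition cu : jcoord := inl false.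
Definition cv : jcoord := inl true.
Definition cd (al : 'I_3) (j k : nat) : jcoord := inr (al, (j, k)).

Definition jet (R : realType) := jcoord -> R.

Definition jbase {R : realType} (w : jet R) : space R :=
  ((w cu, w cv), \row_al w (cd al 0 0)).

Definition pull {R : realType} (f : space R -> R) : jet R -> R :=
  fun w => f (jbase w).

Definition jpartial {R : realType} (c : jcoord) (F : jet R -> R) : jet R -> R :=
  fun w => derive1 (fun t : R => F [eta w with c |-> t]) (w c).

(* Total derivatives, with the sum truncated to |J| <= n: this is the total
   derivative on functions of the jet coordinates of order at most n. *)
Definition Du {R : realType} (n : nat) (F : jet R -> R) : jet R -> R :=
  fun w => jpartial cu F w +
    \sum_(al < 3) \sum_(j < n.+1) \sum_(k < n.+1 | (j + k <= n)%N)
      w (cd al j.+1 k) * jpartial (cd al j k) F w.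
Definition Dv {R : realType} (n : nat) (F : jet R -> R) : jet R -> R :=
  fun w => jpartial cv F w +
    \sum_(al < 3) \sum_(j < n.+1) \sum_(k < n.+1 | (j + k <= n)%N)
      w (cd al j k.+1) * jpartial (cd al j k) F w.
Definition DJ {R : realType} (n j k : nat) (F : jet R -> R) : jet R -> R :=
  iter j (Du n) (iter k (Dv n) F).

(* phi^J_al for J = (j, k), 1 <= |J| <= n. The inner function has order 1, so
   total derivatives are only applied to functions of order at most |J| <= n;
   the terms of order |J| + 1 cancel. *)
Definition prolong_coef {R : realType} (n : nat) (X : vfield R) (al : 'I_3)
    (j k : nat) : jet R -> R :=
  fun w =>
    DJ n j k (fun w' => pull (vf_dep X al) w'
                        - (pull (vf_u X) w' * w' (cd al 1 0)
                           + pull (vf_v X) w' * w' (cd al 0 1))) w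
    + (pull (vf_u X) w * w (cd al j.+1 k) + pull (vf_v X) w * w (cd al j k.+1)).

(* pr^(n) X [F] *)
Definition prolong {R : realType} (n : nat) (X : vfield R) (F : jet R -> R) :
    jet R -> R :=
  fun w =>
    pull (vf_u X) w * jpartial cu F w + pull (vf_v X) w * jpartial cv F w
    + \sum_(al < 3) pull (vf_dep X al) w * jpartial (cd al 0 0) F w
    + \sum_(al < 3) \sum_(j < n.+1) \sum_(k < n.+1 | (0 < j + k <= n)%N)
        prolong_coef n X al j k w * jpartial (cd al j k) F w.

Definition infinitesimal_symmetry {R : realType} (n : nat) (M : set (space R))
    (I : Type) (Delta : I -> jet R -> R) (X : vfield R) : Prop :=
  smooth_vfield M X /\
  forall w : jet R, M (jbase w) -> (forall nu, Delta nu w = 0) ->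
    forall nu, prolong n X (Delta nu) w = 0.

Definition base_vfield {R : realType} (zeta eta : R * R -> R) : vfield R :=
  VField (fun q => zeta q.1) (fun q => eta q.1) (fun _ _ => 0).

Definition eq_vfield_on {R : realType} (M : set (space R)) (X Y : vfield R) :
    Prop :=
  forall q, M q -> [/\ vf_u X q = vf_u Y q, vf_v X q = vf_v Y q
                     & forall al, vf_dep X al q = vf_dep Y al q].

Inductive eq_kind := eq_uu | eq_uv | eq_vv.

(* theta_uu = a theta_u + b theta_v, theta_uv = h theta,
   theta_vv = a'' theta_u + b'' theta_v for each theta = u^al *)
Definition system {R : realType} (a b h a'' b'' : R * R -> R)
    (nu : eq_kind * 'I_3) : jet R -> R :=
  fun w =>
    let p := (w cu, w cv) in
    let th := fun j k => w (cd nu.2 j k) in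
    match nu.1 with
    | eq_uu => th 2 0 - (a p * th 1 0 + b p * th 0 1)
    | eq_uv => th 1 1 - h p * th 0 0
    | eq_vv => th 0 2 - (a'' p * th 1 0 + b'' p * th 0 1)
    end.

Definition in_alg_G {R : realType} (D : set (R * R))
    (a b h a'' b'' : R * R -> R) (X : vfield R) : Prop :=
  infinitesimal_symmetry 2 (D `*` setT) (system a b h a'' b'') X.

Definition in_alg_G2 {R : realType} (D : set (R * R))
    (a b h a'' b'' : R * R -> R) (X : vfield R) : Prop :=
  in_alg_G D a b h a'' b'' X /\
  exists zeta eta : R * R -> R,
    eq_vfield_on (D `*` setT) X (base_vfield zeta eta).

(* Main.v *)
Require Import Defs.
From mathcomp Require Import all_boot all_order all_algebra.
From mathcomp Require Import all_classical all_reals all_analysis.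
From mathcomp Require Import ring lra.
Import Order.TTheory GRing.Theory Num.Theory.
Import numFieldNormedType.Exports.
Local Open Scope classical_set_scope.
Local Open Scope ring_scope.

Set Implicit Arguments.
Unset Strict Implicit.
Unset Printing Implicit Defensive.

(* The characteristic of zeta d/du + eta d/dv is - zeta theta_u - eta theta_v,
   which is linear in the derivatives of theta with coefficients on D, and
   total derivatives preserve such expressions. On solutions the second-order
   jet coordinates are determined and theta, theta_u, theta_v are free, so
   invariance of the system amounts to the vanishing of their coefficients. The
   coefficients of theta in the equations for theta_uu and theta_vv are
   -2 h eta_u and -2 h zeta_v; as h <> 0 this gives eta_u = zeta_v = 0, and
   then the other coefficients are the five equations. *)

(** * Smooth functions and directional derivatives *)

Section DirectionalDerivatives.
Context {R : realType}.

(** Only the line through [x] matters, so this serves linear maps [L] as well as the affine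
    insertions [t |-> (t, y)] and [t |-> (x, t)] behind partial derivatives. *)
Lemma comp_line_quotient {V W : normedModType R} (f : W -> R) (L : V -> W)
    (x v : V) (v' : W) : (forall t : R, L (t *: v + x) = t *: v' + L x) ->
  (fun t : R => t^-1 *: (((f \o L) \o shift x) (t *: v) - (f \o L) x))
  = (fun t : R => t^-1 *: ((f \o shift (L x)) (t *: v') - f (L x))).
Proof. by move=> Lv; apply/funext => t /=; rewrite Lv. Qed.

Lemma is_derive_comp_line {V W : normedModType R} (f : W -> R) (L : V -> W)
    (x v : V) (v' : W) : (forall t : R, L (t *: v + x) = t *: v' + L x) ->
  derivable f (L x) v' -> is_derive x v (f \o L) ('D_v' f (L x)).
Proof.
move=> Lv df.
by apply: DeriveDef; rewrite /derivable /derive (comp_line_quotient _ Lv).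
Qed.

(** Since [U] is open, agreement on [U] is agreement near each of its points, so continuity and
    derivability transfer. The directional derivatives then agree on [U] too, which feeds the
    induction on [k]. *)
Lemma Ck_eq {V : normedModType R} (k : nat) (U : set V) (f g : V -> R) :
  open U -> (forall x, U x -> f x = g x) -> Ck k U f -> Ck k U g.
Proof.
move=> oU; have nearU (f1 g1 : V -> R) x : (forall x, U x -> f1 x = g1 x) ->
    U x -> \forall y \near x, f1 y = g1 y.
  by move=> fg Ux; near=> y; apply: fg; near: y; exact: open_nbhs_nbhs.
have near_cont (f1 g1 : V -> R) x : (forall x, U x -> f1 x = g1 x) -> U x ->
    {for x, continuous f1} -> {for x, continuous g1}.
  move=> fg Ux cf; have {cf} : f1 y @[y --> x] --> f1 x := cf.
  rewrite (fg x Ux) => cf; apply: cvg_trans cf.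
  by apply: near_eq_cvg; apply: nearU.
elim: k f g => [|k IH] f g fg /= [cf df].
  by split=> // x Ux; apply: near_cont (cf x Ux).
split=> [x Ux|v]; first exact: near_cont (cf x Ux).
have [dfv Cdf] := df v; split=> [x Ux|].
  by apply: near_eq_derivable (dfv x Ux); exact: nearU.
by apply: IH Cdf => x Ux; apply: near_eq_derive; exact: nearU.
Unshelve. all: by end_near. Qed.

Lemma smooth_eq {V : normedModType R} (U : set V) (f g : V -> R) :
  open U -> (forall x, U x -> f x = g x) -> smooth U f -> smooth U g.
Proof. by move=> oU fg sf k; exact: Ck_eq (sf k). Qed.

Lemma smooth_comp_linear {V W : normedModType R} (L : V -> W) (U : set W)
    (f : W -> R) :
  (forall (t : R) v x, L (t *: v + x) = t *: L v + L x) -> continuous L ->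
  smooth U f -> smooth (L @^-1` U) (f \o L).
Proof.
move=> linL cL sf k; elim: k f {sf}(sf k) => [|k IH] f /= [cf df].
  by split=> // x Ux; apply: continuous_comp; [exact: cL | exact: cf].
split=> [x Ux|v]; first by apply: continuous_comp; [exact: cL | exact: cf].
have [dfv Cdf] := df (L v); split=> [x Ux|].
  have [] // := is_derive_comp_line (fun t => linL t v x) (dfv _ Ux).
(* Both sides are limits of the same difference quotients, so this is an equality of functions on
   all of [V], derivable or not. *)
have -> : 'D_v (f \o L) = 'D_(L v) f \o L.
  apply/funext => x; rewrite /derive /=.
  by rewrite -(comp_line_quotient f (fun t => linL t v x)).
exact: IH.
Qed.

Lemma smooth_cst {V : normedModType R} (U : set V) (c : R) :
  smooth U (fun=> c).
Proof.
move=> k; elim: k c => [|k IH] c /=; first by split=> // x _; exact: cvg_cst.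
split=> [x _|v]; first exact: cvg_cst.
split=> [x _|]; first exact: derivable_cst.
have -> : 'D_v (fun _ : V => c) = (fun=> 0).
  by apply/funext => x; exact: derive_cst.
exact: IH.
Qed.

Lemma smooth_derivable {V : normedModType R} (U : set V) (f : V -> R) v x :
  smooth U f -> U x -> derivable f x v.
Proof. by move=> /(_ 1%N) [_ /(_ v) [d _]]; exact: d. Qed.

Lemma smooth_derive {V : normedModType R} (U : set V) (f : V -> R) v :
  smooth U f -> smooth U ('D_v f).
Proof. by move=> sf k; have [_ /(_ v) []] := sf k.+1. Qed.

Lemma derive_eq_open {V : normedModType R} (U : set V) (f g : V -> R) v x :
  open U -> (forall y, U y -> f y = g y) -> U x -> 'D_v f x = 'D_v g x.
Proof.
move=> oU fg Ux; apply: near_eq_derive; near=> y; apply: fg; near: y.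
exact: open_nbhs_nbhs.
Unshelve. all: by end_near. Qed.

(** Turns a partial derivative into a one-variable derivative, to which the product rule and the
    mean value theorem apply. *)
Lemma is_derive_du (D : set (R * R)) (f : R * R -> R) (x y : R) :
    smooth D f -> D (x, y) ->
  is_derive x (1 : R) (fun t => f (t, y)) (du f (x, y)).
Proof.
move=> sf Dxy; apply: (@is_derive_comp_line R^o _ f (fun t => (t, y))) => [t|].
  by apply/pair_equal_spec; rewrite /= scaler0 add0r.
exact: smooth_derivable sf Dxy.
Qed.

Lemma is_derive_dv (D : set (R * R)) (f : R * R -> R) (x y : R) :
    smooth D f -> D (x, y) ->
  is_derive y (1 : R) (fun t => f (x, t)) (dv f (x, y)).
Proof.
move=> sf Dxy; apply: (@is_derive_comp_line R^o _ f (fun t => (x, t))) => [t|].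
  by apply/pair_equal_spec; rewrite /= scaler0 add0r.
exact: smooth_derivable sf Dxy.
Qed.

Lemma derive1_val (g : R -> R) (x d : R) :
  is_derive x (1 : R) g d -> derive1 g x = d.
Proof. by move=> [_ <-]; rewrite derive1E. Qed.

Lemma derive0_segment (g : R -> R) (a b : R) : a <= b ->
  (forall t, a <= t <= b -> is_derive t (1 : R) g 0) -> g a = g b.
Proof.
move=> ab dg.
have [||c _ /eqP] := @MVT_segment R g (fun=> 0) a b ab.
- by move=> t; rewrite in_itv /= => /andP[at_ tb]; apply: dg; rewrite !ltW.
- apply: derivable_within_continuous => t; rewrite in_itv /= => tab.
  by have [] := dg t tab.
by rewrite mul0r subr_eq0 => /eqP.
Qed.

(** Balls of the product norm are boxes, so the axis-parallel segments joining points of the box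
    stay in [D]. *)
Lemma open_box (D : set (R * R)) x y : open D -> D (x, y) ->
  exists2 e : R, 0 < e &
    forall x' y', `|x - x'| < e -> `|y - y'| < e -> D (x', y').
Proof.
move=> oD Dxy; have /nbhs_ballP[e /= e0 eD] : nbhs (x, y) D.
  exact: open_nbhs_nbhs.
by exists e => // x' y' xx' yy'; apply: eD.
Qed.

Lemma segment_near (y e s t : R) :
  `|y - t| < e -> (y <= s <= t) || (t <= s <= y) -> `|y - s| < e.
Proof.
rewrite !ltr_norml => /andP[h1 h2] /orP[] /andP[h3 h4]; apply/andP; split; lra.
Qed.

(** A vanishing [dv f] makes [f] constant on vertical segments by the mean value theorem.
    Conversely, short vertical segments around a point stay in [D], so [f] is locally constant in
    [v]. *)
Lemma function_of_uP (D : set (R * R)) (f : R * R -> R) :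
  open D -> smooth D f ->
  function_of_u D f <-> (forall p, D p -> dv f p = 0).
Proof.
move=> oD sf; split=> [fu [x y] Dxy|f0 u v v' vv' seg]; last first.
  apply: (@derive0_segment (fun t => f (u, t)) v v' vv') => t /seg Dt.
  rewrite -(f0 _ Dt); exact: (is_derive_dv sf Dt).
have [e e0 eD] := open_box oD Dxy.
have := @derive_val _ _ _ _ _ _ _ (is_derive_dv sf Dxy).
move=> <-; rewrite -[RHS](derive_cst (f (x, y)) (y : R^o) 1).
apply: near_eq_derive; near=> t.
have yt : `|y - t| < e by near: t; exact: nbhsx_ballx.
have box s : (y <= s <= t) || (t <= s <= y) -> D (x, s).
  by move=> st; apply: eD; [rewrite subrr normr0 | apply: segment_near yt st].
case: (leP y t) => [le|/ltW le].
  by symmetry; apply: fu le _ => s st; apply: box; rewrite st.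
by apply: fu le _ => s st; apply: box; rewrite st orbT.
Unshelve. all: by end_near. Qed.

Lemma function_of_vP (D : set (R * R)) (f : R * R -> R) :
  open D -> smooth D f ->
  function_of_v D f <-> (forall p, D p -> du f p = 0).
Proof.
move=> oD sf; split=> [fv [x y] Dxy|f0 u u' v uu' seg]; last first.
  apply: (@derive0_segment (fun t => f (t, v)) u u' uu') => t /seg Dt.
  rewrite -(f0 _ Dt); exact: (is_derive_du sf Dt).
have [e e0 eD] := open_box oD Dxy.
have := @derive_val _ _ _ _ _ _ _ (is_derive_du sf Dxy).
move=> <-; rewrite -[RHS](derive_cst (f (x, y)) (x : R^o) 1).
apply: near_eq_derive; near=> t.
have xt : `|x - t| < e by near: t; exact: nbhsx_ballx.
have box s : (x <= s <= t) || (t <= s <= x) -> D (s, y).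
  by move=> st; apply: eD; [apply: segment_near xt st | rewrite subrr normr0].
case: (leP x t) => [le|/ltW le].
  by symmetry; apply: fv le _ => s st; apply: box; rewrite st.
by apply: fv le _ => s st; apply: box; rewrite st orbT.
Unshelve. all: by end_near. Qed.

(** Symmetry of mixed partials is avoided: near (x, y) the functions f(x, .) and f(t, .) coincide,
    hence so do their derivatives at y, and [dv f] is locally constant in u. *)
Lemma du_dv_function_of_v (D : set (R * R)) (f : R * R -> R) p :
  open D -> smooth D f -> function_of_v D f -> D p -> du (dv f) p = 0.
Proof.
move=> oD sf fv; case: p => x y Dxy.
have [e e0 eD] := open_box oD Dxy.
have := @derive_val _ _ _ _ _ _ _
  (is_derive_du (smooth_derive _ sf) Dxy).
move=> <-; rewrite -[RHS](derive_cst (dv f (x, y)) (x : R^o) 1).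
apply: near_eq_derive; near=> t.
have xt : `|x - t| < e by near: t; exact: nbhsx_ballx.
have Dty : D (t, y) by apply: eD => //; rewrite subrr normr0.
have := @derive_val _ _ _ _ _ _ _ (is_derive_dv sf Dty).
have := @derive_val _ _ _ _ _ _ _ (is_derive_dv sf Dxy).
move=> <- E; apply: etrans (esym E) _; apply: near_eq_derive; near=> s.
have ys : `|y - s| < e by near: s; exact: nbhsx_ballx.
have box r : (x <= r <= t) || (t <= r <= x) -> D (r, s).
  by move=> rt; apply: eD => //; exact: segment_near xt rt.
case: (leP x t) => [le|/ltW le].
  by symmetry; apply: fv le _ => r rt; apply: box; rewrite rt.
by apply: fv le _ => r rt; apply: box; rewrite rt orbT.
Unshelve. all: by end_near. Qed.

End DirectionalDerivatives.

(** * Derivatives of opposites, needed for the signs in the characteristic and in the system *)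

Section Negation.
Context {R : realType} {V : normedModType R}.
Implicit Types (U : set V) (f : V -> R).

Lemma derive_opp U f v x : smooth U f -> U x ->
  'D_v (fun y => - f y) x = - 'D_v f x.
Proof. by move=> sf Ux; rewrite deriveN//; exact: smooth_derivable sf Ux. Qed.

Lemma smooth_opp U f : open U -> smooth U f -> smooth U (fun y => - f y).
Proof.
move=> oU sf k; elim: k f sf => [|k IH] f sf /=.
  by split=> // x Ux; apply: continuousN; have [cf _] := sf 0%N; exact: cf.
have cf x : U x -> {for x, continuous (fun y => - f y)}.
  by move=> Ux; apply: continuousN; have [cf _] := sf 0%N; exact: cf.
split=> // v; split=> [x Ux|].
  by apply: derivableN; exact: smooth_derivable sf Ux.
apply: Ck_eq (IH _ (smooth_derive v sf)) => // x Ux.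
by rewrite (derive_opp _ sf).
Qed.

(** The inner derivative is known to commute with negation on [U] only, and openness of [U] allows
    the replacement under the outer derivative. *)
Lemma derive_derive_opp U f v v' x : open U -> smooth U f -> U x ->
  'D_v' ('D_v (fun y => - f y)) x = - 'D_v' ('D_v f) x.
Proof.
move=> oU sf Ux; rewrite -(derive_opp _ (smooth_derive v sf) Ux).
by apply: derive_eq_open Ux => // y Uy; exact: derive_opp sf Uy.
Qed.

End Negation.

Section PartialDerivativesOpp.
Context {R : realType}.
Variables (D : set (R * R)) (f : R * R -> R) (p : R * R).
Hypotheses (openD : open D) (smooth_f : smooth D f) (Dp : D p).

Lemma du_opp : du (fun y => - f y) p = - du f p.
Proof. exact: derive_opp smooth_f Dp. Qed.

Lemma dv_opp : dv (fun y => - f y) p = - dv f p.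
Proof. exact: derive_opp smooth_f Dp. Qed.

Lemma du_du_opp : du (du (fun y => - f y)) p = - du (du f) p.
Proof. exact: derive_derive_opp openD smooth_f Dp. Qed.

Lemma du_dv_opp : du (dv (fun y => - f y)) p = - du (dv f) p.
Proof. exact: derive_derive_opp openD smooth_f Dp. Qed.

Lemma dv_dv_opp : dv (dv (fun y => - f y)) p = - dv (dv f) p.
Proof. exact: derive_derive_opp openD smooth_f Dp. Qed.

Lemma du_cst (c : R) : du (fun=> c) p = 0.
Proof. exact: derive_cst. Qed.

Lemma dv_cst (c : R) : dv (fun=> c) p = 0.
Proof. exact: derive_cst. Qed.

End PartialDerivativesOpp.

(** * Expressions linear in the derivatives of a dependent variable *)

Section LinearDifferentialFunctions.
Context {R : realType}.
Variables (D : set (R * R)) (al : 'I_3).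
Hypothesis openD : open D.

(* The term (f, (j, k)) stands for f(u, v) d^(j+k) u^al / du^j dv^k. *)
Definition lindiff (s : seq ((R * R -> R) * (nat * nat))) : jet R -> R :=
  fun w => \sum_(t <- s) t.1 (w cu, w cv) * w (cd al t.2.1 t.2.2).

Definition jets_over (w : jet R) : Prop := D (w cu, w cv).

Fixpoint smooth_coefs (s : seq ((R * R -> R) * (nat * nat))) : Prop :=
  if s is t :: s' then smooth D t.1 /\ smooth_coefs s' else True.

Lemma lindiff_nil : lindiff [::] = cst 0.
Proof. by apply/funext => w; rewrite /lindiff big_nil. Qed.

Lemma lindiff_cons t s : lindiff (t :: s) =
  fun w => t.1 (w cu, w cv) * w (cd al t.2.1 t.2.2) + lindiff s w.
Proof. by apply/funext => w; rewrite /lindiff big_cons. Qed.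

(** A small change of a single jet coordinate moves the base point by little or not at all, so it
    remains in the open set [D]. *)
Lemma jpartial_eq (F G : jet R -> R) c w :
  (forall w', jets_over w' -> F w' = G w') -> jets_over w ->
  jpartial c F w = jpartial c G w.
Proof.
move=> FG Dw; rewrite /jpartial !derive1E; apply: near_eq_derive.
have [e e0 eD] := open_box openD Dw; near=> t; apply: FG.
have wt : `|w c - t| < e by near: t; exact: nbhsx_ballx.
by apply: eD => /=; case: eqP => [->|_] //; rewrite subrr normr0.
Unshelve. all: by end_near. Qed.

Lemma is_derive_lindiff_cu s w : smooth_coefs s -> jets_over w ->
  is_derive (w cu) (1 : R) (fun t => lindiff s [eta w with cu |-> t])
    (lindiff [seq (du t.1, t.2) | t <- s] w).
Proof.
elim: s => [|[f [j k]] s IH] /= => [_|[sf ss]] Dw.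
  by rewrite lindiff_nil; exact: is_derive_cst.
rewrite !lindiff_cons /=.
apply: is_deriveD; last exact: IH.
apply: is_derive_eq.
  apply: is_deriveM (is_derive_du sf Dw) (is_derive_cst _ _ _).
by rewrite scaler0 add0r /GRing.scale /= mulrC.
Qed.

Lemma is_derive_lindiff_cv s w : smooth_coefs s -> jets_over w ->
  is_derive (w cv) (1 : R) (fun t => lindiff s [eta w with cv |-> t])
    (lindiff [seq (dv t.1, t.2) | t <- s] w).
Proof.
elim: s => [|[f [j k]] s IH] /= => [_|[sf ss]] Dw.
  by rewrite lindiff_nil; exact: is_derive_cst.
rewrite !lindiff_cons /=.
apply: is_deriveD; last exact: IH.
apply: is_derive_eq.
  apply: is_deriveM (is_derive_dv sf Dw) (is_derive_cst _ _ _).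
by rewrite scaler0 add0r /GRing.scale /= mulrC.
Qed.

(** The expression is linear in the derivative coordinates. The list may contain several terms with
    the same index, so the coefficient is a sum of Kronecker deltas. *)
Lemma is_derive_lindiff_cd s be j k w :
  is_derive (w (cd be j k)) (1 : R)
    (fun t => lindiff s [eta w with cd be j k |-> t])
    (\sum_(t <- s) t.1 (w cu, w cv) * ((be, (j, k)) == (al, t.2))%:R).
Proof.
elim: s => [|[f [j' k']] s IH].
  by rewrite lindiff_nil big_nil; exact: is_derive_cst.
rewrite lindiff_cons big_cons /=.
apply: is_deriveD.
have dcoord : is_derive (w (cd be j k)) (1 : R)
    (fun t => [eta w with cd be j k |-> t] (cd al j' k'))
    ((be, (j, k)) == (al, (j', k')))%:R.
  have E : (cd al j' k' == cd be j k) = ((be, (j, k)) == (al, (j', k'))).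
    by rewrite eq_sym.
  by rewrite /= E; case: eqP => _; [exact: is_derive_id | exact: is_derive_cst].
apply: is_derive_eq (is_deriveM (is_derive_cst (f (w cu, w cv)) _ _) dcoord) _.
by rewrite scaler0 addr0 /GRing.scale /=.
Qed.

Lemma jpartial_lindiff_cd s be j k w :
  jpartial (cd be j k) (lindiff s) w =
  \sum_(t <- s) t.1 (w cu, w cv) * ((be, (j, k)) == (al, t.2))%:R.
Proof.
by rewrite /jpartial (derive1_val (is_derive_lindiff_cd s be j k w)).
Qed.

(** The Kronecker delta leaves one index, and [(P j0 k0)%:R] records whether the truncation of the
    sum keeps it. *)
Lemma sum_multiindex (n j0 k0 : nat) (P : nat -> nat -> bool)
    (G : 'I_3 -> nat -> nat -> R) : (j0 < n)%N -> (k0 < n)%N ->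
  \sum_(be < 3) \sum_(j < n) \sum_(k < n | P j k)
      G be j k * ((be, (j : nat, k : nat)) == (al, (j0, k0)))%:R
  = (P j0 k0)%:R * G al j0 k0.
Proof.
move=> jn kn; rewrite (bigD1 al) //= [X in _ + X]big1 ?addr0; last first.
  move=> be neq; apply: big1 => j _; apply: big1 => k _.
  by rewrite xpair_eqE (negbTE neq) mulr0.
rewrite (bigD1 (Ordinal jn)) //= [X in _ + X]big1 ?addr0; last first.
  move=> j neq; apply: big1 => k _; rewrite !xpair_eqE.
  suff -> : ((j : nat) == j0) = false by rewrite andbF mulr0.
  by apply: contraNF neq => /eqP jj0; apply/eqP/val_inj.
rewrite big_mkcond (bigD1 (Ordinal kn)) //= [X in _ + X]big1 ?addr0; last first.
  move=> k neq; case: ifP => // _; rewrite !xpair_eqE.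
  suff -> : ((k : nat) == k0) = false by rewrite !andbF mulr0.
  by apply: contraNF neq => /eqP kk0; apply/eqP/val_inj.
by rewrite eqxx mulr1; case: (P j0 k0); rewrite ?mul1r ?mul0r.
Qed.

(** Trades the sum over jet coordinates for a sum over the terms of [s]. It is used for total
    derivatives, with [G] the shifted coordinate, and for prolongations, with [G] the prolongation
    coefficient. *)
Lemma sum_jpartial_lindiff (n : nat) (P : nat -> nat -> bool)
    (G : 'I_3 -> nat -> nat -> R) s w :
    all (fun t => (t.2.1 < n)%N && (t.2.2 < n)%N) s ->
  \sum_(be < 3) \sum_(j < n) \sum_(k < n | P j k)
      G be j k * jpartial (cd be j k) (lindiff s) w
  = \sum_(t <- s) t.1 (w cu, w cv) * ((P t.2.1 t.2.2)%:R * G al t.2.1 t.2.2).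
Proof.
elim: s => [|[f [j0 k0]] s IH] /=.
  move=> _; rewrite big_nil; do 3 (apply: big1 => ? _).
  by rewrite jpartial_lindiff_cd big_nil mulr0.
move=> /andP[/andP[jn kn] /IH{}IH]; rewrite big_cons -IH /=.
rewrite -(sum_multiindex P G jn kn) mulr_sumr -big_split.
apply: eq_bigr => be _.
rewrite mulr_sumr -big_split; apply: eq_bigr => j _.
rewrite mulr_sumr -big_split; apply: eq_bigr => k _ /=.
by rewrite !jpartial_lindiff_cd big_cons /=; ring.
Qed.

(** Product rule: the total derivative of f theta_J is f_u theta_J + f theta_(J,u), and likewise for
    v. *)
Definition lin_Du (s : seq ((R * R -> R) * (nat * nat))) :=
  [seq (du t.1, t.2) | t <- s] ++ [seq (t.1, (t.2.1.+1, t.2.2)) | t <- s].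
Definition lin_Dv (s : seq ((R * R -> R) * (nat * nat))) :=
  [seq (dv t.1, t.2) | t <- s] ++ [seq (t.1, (t.2.1, t.2.2.+1)) | t <- s].

Definition order_le n (s : seq ((R * R -> R) * (nat * nat))) :=
  all (fun t => t.2.1 + t.2.2 <= n)%N s.

Lemma order_leW n s : order_le n s ->
  all (fun t => (t.2.1 < n.+1)%N && (t.2.2 < n.+1)%N) s.
Proof.
apply: sub_all => t tn; rewrite !ltnS.
by rewrite (leq_trans (leq_addr _ _) tn) (leq_trans (leq_addl _ _) tn).
Qed.

Lemma Du_lindiff n s w : smooth_coefs s -> order_le n s -> jets_over w ->
  Du n (lindiff s) w = lindiff (lin_Du s) w.
Proof.
move=> ss sn Dw; rewrite /Du {1}/jpartial.
rewrite (derive1_val (is_derive_lindiff_cu ss Dw)).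
rewrite (@sum_jpartial_lindiff _ (fun j k => j + k <= n)%N
  (fun be j k => w (cd be j.+1 k))) ?order_leW//.
rewrite /lindiff big_cat !big_map; congr (_ + _).
(* Every term has order at most [n], so the truncation in [Du] loses nothing and its boolean factor
   is 1. *)
rewrite !big_seq; apply: eq_bigr => t /(allP sn) /= ->.
by rewrite mul1r.
Qed.

Lemma Dv_lindiff n s w : smooth_coefs s -> order_le n s -> jets_over w ->
  Dv n (lindiff s) w = lindiff (lin_Dv s) w.
Proof.
move=> ss sn Dw; rewrite /Dv {1}/jpartial.
rewrite (derive1_val (is_derive_lindiff_cv ss Dw)).
rewrite (@sum_jpartial_lindiff _ (fun j k => j + k <= n)%N
  (fun be j k => w (cd be j k.+1))) ?order_leW//.
rewrite /lindiff big_cat !big_map; congr (_ + _).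
rewrite !big_seq; apply: eq_bigr => t /(allP sn) /= ->.
by rewrite mul1r.
Qed.

Lemma Du_eq n (F G : jet R -> R) w :
  (forall w', jets_over w' -> F w' = G w') -> jets_over w ->
  Du n F w = Du n G w.
Proof.
move=> FG Dw; rewrite /Du (jpartial_eq _ FG Dw); congr (_ + _).
do 3 (apply: eq_bigr => ? _); by rewrite (jpartial_eq _ FG Dw).
Qed.

Lemma Dv_eq n (F G : jet R -> R) w :
  (forall w', jets_over w' -> F w' = G w') -> jets_over w ->
  Dv n F w = Dv n G w.
Proof.
move=> FG Dw; rewrite /Dv (jpartial_eq _ FG Dw); congr (_ + _).
do 3 (apply: eq_bigr => ? _); by rewrite (jpartial_eq _ FG Dw).
Qed.

End LinearDifferentialFunctions.

(** * Prolongation of vector fields on the base *)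

Section Prolongation.
Context {R : realType}.
Variables (D : set (R * R)) (X : vfield R) (zeta eta : R * R -> R).
Hypothesis openD : open D.
Hypotheses (smooth_zeta : smooth D zeta) (smooth_eta : smooth D eta).
Hypothesis eqX : eq_vfield_on (D `*` setT) X (base_vfield zeta eta).

Lemma pull_base w : jets_over D w ->
  [/\ pull (vf_u X) w = zeta (w cu, w cv), pull (vf_v X) w = eta (w cu, w cv)
    & forall al, pull (vf_dep X al) w = 0].
Proof. by move=> Dw; exact: (eqX (q := jbase w)). Qed.

(** The dependent components of [X] vanish over [D], so a term of order zero contributes only
    through its coefficient. The boolean factor removes exactly these terms from the last sum. *)
Lemma prolong_lindiff n al s w :
    smooth_coefs D s -> order_le n s -> jets_over D w ->
  prolong n X (lindiff al s) w =
    zeta (w cu, w cv) * lindiff al [seq (du t.1, t.2) | t <- s] w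
    + eta (w cu, w cv) * lindiff al [seq (dv t.1, t.2) | t <- s] w
    + \sum_(t <- s) t.1 (w cu, w cv) *
        ((0 < t.2.1 + t.2.2 <= n)%N%:R * prolong_coef n X al t.2.1 t.2.2 w).
Proof.
move=> ss sn Dw; rewrite /prolong {1 2}/jpartial.
rewrite (derive1_val (is_derive_lindiff_cu al ss Dw)).
rewrite (derive1_val (is_derive_lindiff_cv al ss Dw)).
have [-> -> dep0] := pull_base Dw.
rewrite [X in _ + X + _]big1 ?addr0; last by move=> be _; rewrite dep0 mul0r.
by rewrite (@sum_jpartial_lindiff _ al _ (fun j k => 0 < j + k <= n)%N
  (fun be j k => prolong_coef n X be j k w)) ?order_leW.
Qed.

Let characteristic :=
  [:: (fun p => - zeta p, (1, 0)%N); (fun p => - eta p, (0, 1)%N)].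

Let coefs_characteristic : smooth_coefs D characteristic.
Proof. by do ![split=> //=]; exact: smooth_opp. Qed.

Lemma characteristicE al w : jets_over D w ->
  pull (vf_dep X al) w - (pull (vf_u X) w * w (cd al 1 0)
                          + pull (vf_v X) w * w (cd al 0 1))
  = lindiff al characteristic w.
Proof.
move=> Dw; have [-> -> ->] := pull_base Dw.
by rewrite /lindiff !big_cons big_nil /=; ring.
Qed.

(** The truncation order is a successor because the characteristic has order 1. *)
Let Du_characteristic n al w : jets_over D w ->
  Du n.+1 (fun w => pull (vf_dep X al) w
    - (pull (vf_u X) w * w (cd al 1 0) + pull (vf_v X) w * w (cd al 0 1))) w
  = lindiff al (lin_Du characteristic) w.
Proof.
move=> Dw; rewrite (Du_eq openD _ (characteristicE al))//.
by rewrite (Du_lindiff (D := D)).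
Qed.

Let Dv_characteristic n al w : jets_over D w ->
  Dv n.+1 (fun w => pull (vf_dep X al) w
    - (pull (vf_u X) w * w (cd al 1 0) + pull (vf_v X) w * w (cd al 0 1))) w
  = lindiff al (lin_Dv characteristic) w.
Proof.
move=> Dw; rewrite (Dv_eq openD _ (characteristicE al))//.
by rewrite (Dv_lindiff (D := D)).
Qed.

Let coefs_Du : smooth_coefs D (lin_Du characteristic).
Proof. by do ![split=> //=]; try apply: smooth_derive; exact: smooth_opp. Qed.

Let coefs_Dv : smooth_coefs D (lin_Dv characteristic).
Proof. by do ![split=> //=]; try apply: smooth_derive; exact: smooth_opp. Qed.

(** The second-order terms of the total derivative cancel against those added in [prolong_coef]. In
    the lemmas on second-order indices below, the third-order terms cancel in the same way. *)
Lemma prolong_coef_10 al w : jets_over D w ->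
  prolong_coef 2 X al 1 0 w =
  - (du zeta (w cu, w cv) * w (cd al 1 0)
     + du eta (w cu, w cv) * w (cd al 0 1)).
Proof.
move=> Dw; rewrite /prolong_coef /DJ /= Du_characteristic //.
have [-> -> _] := pull_base Dw.
rewrite /lindiff !big_cons big_nil /=.
rewrite (du_opp smooth_zeta Dw) (du_opp smooth_eta Dw).
(* ring would compare derivatives up to unfolding, which is slow, so they are
   abstracted first. *)
do ?[move: (du _ _) => ?].
ring.
Qed.

Lemma prolong_coef_01 al w : jets_over D w ->
  prolong_coef 2 X al 0 1 w =
  - (dv zeta (w cu, w cv) * w (cd al 1 0)
     + dv eta (w cu, w cv) * w (cd al 0 1)).
Proof.
move=> Dw; rewrite /prolong_coef /DJ /= Dv_characteristic //.
have [-> -> _] := pull_base Dw.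
rewrite /lindiff !big_cons big_nil /=.
rewrite (dv_opp smooth_zeta Dw) (dv_opp smooth_eta Dw).
do ?[move: (dv _ _) => ?].
ring.
Qed.

Lemma prolong_coef_20 al w (p := (w cu, w cv)) : jets_over D w ->
  prolong_coef 2 X al 2 0 w =
  - (du (du zeta) p * w (cd al 1 0) + du (du eta) p * w (cd al 0 1)
     + 2 * (du zeta p * w (cd al 2 0) + du eta p * w (cd al 1 1))).
Proof.
move=> Dw; rewrite /prolong_coef /DJ /=.
rewrite (Du_eq openD _ (Du_characteristic 1 al)) //.
rewrite (Du_lindiff (D := D)) //.
have [-> -> _] := pull_base Dw.
rewrite /lindiff !big_cons big_nil /=.
rewrite (du_opp smooth_zeta Dw) (du_opp smooth_eta Dw).
rewrite (du_du_opp openD smooth_zeta Dw) (du_du_opp openD smooth_eta Dw) -/p.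
do ?[move: (du _ _) => ?].
ring.
Qed.

(** [DJ] applies [Dv] before [Du], so the mixed derivatives appear as [du (dv _)]. *)
Lemma prolong_coef_11 al w (p := (w cu, w cv)) : jets_over D w ->
  prolong_coef 2 X al 1 1 w =
  - (du (dv zeta) p * w (cd al 1 0) + du (dv eta) p * w (cd al 0 1)
     + dv zeta p * w (cd al 2 0) + (du zeta p + dv eta p) * w (cd al 1 1)
     + du eta p * w (cd al 0 2)).
Proof.
move=> Dw; rewrite /prolong_coef /DJ /=.
rewrite (Du_eq openD _ (Dv_characteristic 1 al)) //.
rewrite (Du_lindiff (D := D)) //.
have [-> -> _] := pull_base Dw.
rewrite /lindiff !big_cons big_nil /=.
rewrite (du_opp smooth_zeta Dw) (du_opp smooth_eta Dw).
rewrite (dv_opp smooth_zeta Dw) (dv_opp smooth_eta Dw).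
rewrite (du_dv_opp openD smooth_zeta Dw) (du_dv_opp openD smooth_eta Dw) -/p.
do ?[move: (du _ _) => ?].
do ?[move: (dv _ _) => ?].
ring.
Qed.

Lemma prolong_coef_02 al w (p := (w cu, w cv)) : jets_over D w ->
  prolong_coef 2 X al 0 2 w =
  - (dv (dv zeta) p * w (cd al 1 0) + dv (dv eta) p * w (cd al 0 1)
     + 2 * (dv zeta p * w (cd al 1 1) + dv eta p * w (cd al 0 2))).
Proof.
move=> Dw; rewrite /prolong_coef /DJ /=.
rewrite (Dv_eq openD _ (Dv_characteristic 1 al)) //.
rewrite (Dv_lindiff (D := D)) //.
have [-> -> _] := pull_base Dw.
rewrite /lindiff !big_cons big_nil /=.
rewrite (dv_opp smooth_zeta Dw) (dv_opp smooth_eta Dw).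
rewrite (dv_dv_opp openD smooth_zeta Dw) (dv_dv_opp openD smooth_eta Dw) -/p.
do ?[move: (dv _ _) => ?].
ring.
Qed.

(** * Prolongation applied to the three types of equation *)

Variables a b h a'' b'' : R * R -> R.
Hypotheses (smooth_a : smooth D a) (smooth_b : smooth D b).
Hypotheses (smooth_h : smooth D h).
Hypotheses (smooth_a'' : smooth D a'') (smooth_b'' : smooth D b'').

Lemma system_uuE al : system a b h a'' b'' (eq_uu, al) =
  lindiff al [:: (fun=> 1, (2, 0)%N); (fun p => - a p, (1, 0)%N);
                 (fun p => - b p, (0, 1)%N)].
Proof.
by apply/funext => w; rewrite /lindiff !big_cons big_nil /system /=; ring.
Qed.

Lemma system_uvE al : system a b h a'' b'' (eq_uv, al) =
  lindiff al [:: (fun=> 1, (1, 1)%N); (fun p => - h p, (0, 0)%N)].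
Proof.
by apply/funext => w; rewrite /lindiff !big_cons big_nil /system /=; ring.
Qed.

Lemma system_vvE al : system a b h a'' b'' (eq_vv, al) =
  lindiff al [:: (fun=> 1, (0, 2)%N); (fun p => - a'' p, (1, 0)%N);
                 (fun p => - b'' p, (0, 1)%N)].
Proof.
by apply/funext => w; rewrite /lindiff !big_cons big_nil /system /=; ring.
Qed.

(** Valid at every jet over [D]: the second-order coordinates are kept here and eliminated only on
    solutions. *)
Lemma prolong_system_uu al w (p := (w cu, w cv)) : jets_over D w ->
  prolong 2 X (system a b h a'' b'' (eq_uu, al)) w =
  - ((zeta p * du a p + eta p * dv a p - a p * du zeta p - b p * dv zeta p
       + du (du zeta) p) * w (cd al 1 0)
     + (zeta p * du b p + eta p * dv b p - a p * du eta p - b p * dv eta p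
       + du (du eta) p) * w (cd al 0 1)
     + 2 * (du zeta p * w (cd al 2 0) + du eta p * w (cd al 1 1))).
Proof.
move=> Dw; rewrite system_uuE prolong_lindiff //; last first.
  by do ![split=> //=]; try exact: smooth_cst; exact: smooth_opp.
rewrite /lindiff !big_cons !big_nil /= ?du_cst ?dv_cst.
rewrite (du_opp smooth_a Dw) (dv_opp smooth_a Dw).
rewrite (du_opp smooth_b Dw) (dv_opp smooth_b Dw).
rewrite prolong_coef_10 // prolong_coef_01 // prolong_coef_20 // -/p.
do ?[move: (du _ _) => ?].
do ?[move: (dv _ _) => ?].
ring.
Qed.

Lemma prolong_system_uv al w (p := (w cu, w cv)) : jets_over D w ->
  prolong 2 X (system a b h a'' b'' (eq_uv, al)) w =
  - ((zeta p * du h p + eta p * dv h p) * w (cd al 0 0)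
     + du (dv zeta) p * w (cd al 1 0) + du (dv eta) p * w (cd al 0 1)
     + dv zeta p * w (cd al 2 0) + (du zeta p + dv eta p) * w (cd al 1 1)
     + du eta p * w (cd al 0 2)).
Proof.
move=> Dw; rewrite system_uvE prolong_lindiff //; last first.
  by do ![split=> //=]; try exact: smooth_cst; exact: smooth_opp.
rewrite /lindiff !big_cons !big_nil /= ?du_cst ?dv_cst.
rewrite (du_opp smooth_h Dw) (dv_opp smooth_h Dw).
rewrite prolong_coef_11 // -/p.
do ?[move: (du _ _) => ?].
do ?[move: (dv _ _) => ?].
ring.
Qed.

Lemma prolong_system_vv al w (p := (w cu, w cv)) : jets_over D w ->
  prolong 2 X (system a b h a'' b'' (eq_vv, al)) w =
  - ((zeta p * du a'' p + eta p * dv a'' p - a'' p * du zeta p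
       - b'' p * dv zeta p + dv (dv zeta) p) * w (cd al 1 0)
     + (zeta p * du b'' p + eta p * dv b'' p - a'' p * du eta p
       - b'' p * dv eta p + dv (dv eta) p) * w (cd al 0 1)
     + 2 * (dv zeta p * w (cd al 1 1) + dv eta p * w (cd al 0 2))).
Proof.
move=> Dw; rewrite system_vvE prolong_lindiff //; last first.
  by do ![split=> //=]; try exact: smooth_cst; exact: smooth_opp.
rewrite /lindiff !big_cons !big_nil /= ?du_cst ?dv_cst.
rewrite (du_opp smooth_a'' Dw) (dv_opp smooth_a'' Dw).
rewrite (du_opp smooth_b'' Dw) (dv_opp smooth_b'' Dw).
rewrite prolong_coef_10 // prolong_coef_01 // prolong_coef_02 // -/p.
do ?[move: (du _ _) => ?].
do ?[move: (dv _ _) => ?].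
ring.
Qed.

End Prolongation.

(** * Smoothness of vector fields on the cylinder over [D] *)

Section BaseVectorFields.
Context {R : realType}.
Variable D : set (R * R).
Hypothesis openD : open D.

Lemma cylinderE : D `*` [set: 'rV[R]_3] = fst @^-1` D.
Proof. by apply/seteqP; split=> // q []. Qed.

Lemma open_cylinder : open (D `*` [set: 'rV[R]_3]).
Proof. by rewrite cylinderE; apply: open_comp => // q _; exact: cvg_fst. Qed.

(** One direction composes with the zero section, the other with the projection; both maps are
    linear and continuous. *)
Lemma smooth_cylinder (f : R * R -> R) :
  smooth (D `*` [set: 'rV[R]_3]) (fun q => f q.1) <-> smooth D f.
Proof.
split=> sf.
  pose L (p : R * R) : Defs.space R := (p, 0).
  have -> : D = L @^-1` (D `*` setT).
    by apply/seteqP; split=> // p [].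
  apply: (@smooth_comp_linear _ _ _ L _ _ _ _ sf) => [t v x|p].
    by rewrite /L; apply/pair_equal_spec; rewrite /= scaler0 addr0.
  exact: cvg_pair (@cvg_id _ (nbhs p)) (cvg_cst _).
rewrite cylinderE.
by apply: (@smooth_comp_linear _ _ _ fst _ _ _ _ sf) => // q; exact: cvg_fst.
Qed.

Lemma smooth_base_vfieldP (X : vfield R) (zeta eta : R * R -> R) :
  eq_vfield_on (D `*` setT) X (base_vfield zeta eta) ->
  smooth_vfield (D `*` setT) X <-> smooth D zeta /\ smooth D eta.
Proof.
move=> eqX; split=> [[su sv _]|[szeta seta]].
  split; apply/smooth_cylinder; [move: su | move: sv];
    by apply: smooth_eq open_cylinder _ => q /eqX[].
split=> [||al].
- by apply: smooth_eq open_cylinder _ ((smooth_cylinder _).2 szeta) => q /eqX[].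
- by apply: smooth_eq open_cylinder _ ((smooth_cylinder _).2 seta) => q /eqX[].
- by apply: smooth_eq open_cylinder _ (smooth_cst _ 0) => q /eqX[_ _ ->].
Qed.

End BaseVectorFields.

(** * The determining equations *)

(* t, tu, tv are arbitrary values of theta, theta_u, theta_v over p. *)
Definition solution_jet {R : realType} (a b h a'' b'' : R * R -> R)
    (p : R * R) (t tu tv : R) : jet R :=
  fun c => match c with
  | inl v => if v then p.2 else p.1
  | inr (_, (0%N, 0%N)) => t
  | inr (_, (1%N, 0%N)) => tu
  | inr (_, (0%N, 1%N)) => tv
  | inr (_, (2%N, 0%N)) => a p * tu + b p * tv
  | inr (_, (1%N, 1%N)) => h p * t
  | inr (_, (0%N, 2%N)) => a'' p * tu + b'' p * tv
  | _ => 0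
  end.

Lemma solution_jetP {R : realType} (a b h a'' b'' : R * R -> R) p t tu tv nu :
  system a b h a'' b'' nu (solution_jet a b h a'' b'' p t tu tv) = 0.
Proof. by case: p nu => x y [[] al]; rewrite /system /= subrr. Qed.

Theorem theorem5 (R : realType) (D : set (R * R)) (a b h a'' b'' : R * R -> R)
  (openD : open D)
  (smooth_a : smooth D a) (smooth_b : smooth D b) (smooth_h : smooth D h)
  (smooth_a'' : smooth D a'') (smooth_b'' : smooth D b'')
  (h_neq0 : forall p, D p -> h p != 0)
  (int1 : forall p, D p -> a p * h p = du h p)
  (int2 : forall p, D p -> dv a p = b p * a'' p + h p)
  (int3 : forall p, D p -> dv b p + b p * b'' p = 0)
  (int4 : forall p, D p -> dv h p = b'' p * h p)
  (int5 : forall p, D p -> du a'' p + a p * a'' p = 0)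
  (int6 : forall p, D p -> h p = du b'' p + a'' p * b p) :
  forall Z : vfield R,
    in_alg_G2 D a b h a'' b'' Z <->
    exists zeta eta : R * R -> R,
      [/\ smooth D zeta /\ smooth D eta,
          eq_vfield_on (D `*` setT) Z (base_vfield zeta eta),
          function_of_u D zeta,
          function_of_v D eta
        & forall p, D p ->
          [/\ zeta p * du a p + eta p * dv a p + a p * du zeta p
                + du (du zeta) p = 0,
              zeta p * du b p + eta p * dv b p - b p * dv eta p
                + 2 * b p * du zeta p = 0,
              zeta p * du h p + eta p * dv h p
                + h p * (du zeta p + dv eta p) = 0,
              zeta p * du a'' p + eta p * dv a'' p - a'' p * du zeta p
                + 2 * a'' p * dv eta p = 0
            & zeta p * du b'' p + eta p * dv b'' p + b'' p * dv eta p
                + dv (dv eta) p = 0]].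
Proof.
have derive0 (f : R * R -> R) v p : (forall p, D p -> f p = 0) -> D p ->
    'D_v f p = 0.
  by move=> f0 Dp; rewrite (derive_eq_open _ openD f0 Dp) derive_cst.
move=> Z; split=> [[[sZ inv] [zeta [eta eqZ]]]|].
  have [szeta seta] := (smooth_base_vfieldP openD eqZ).1 sZ.
  pose S := solution_jet a b h a'' b''.
  have over p t tu tv : D p -> jets_over D (S p t tu tv) by case: p.
  (* The three dependent variables satisfy the same equations, so one component, here [ord0], yields
     all the conditions. *)
  have invS k p t tu tv : D p ->
      prolong 2 Z (system a b h a'' b'' (k, ord0)) (S p t tu tv) = 0.
    by case: p => x y Dp; apply: inv => // nu; exact: solution_jetP.
  (* This identity and the next two are linear in the free values [t], [tu], [tv]; setting one of
     them to 1 and the others to 0 extracts its coefficient. *)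
  have Suu p t tu tv : D p ->
      (zeta p * du a p + eta p * dv a p - a p * du zeta p - b p * dv zeta p
        + du (du zeta) p) * tu
      + (zeta p * du b p + eta p * dv b p - a p * du eta p - b p * dv eta p
        + du (du eta) p) * tv
      + 2 * (du zeta p * (a p * tu + b p * tv) + du eta p * (h p * t)) = 0.
    move=> Dp; have := prolong_system_uu openD szeta seta eqZ h a'' b''
      smooth_a smooth_b ord0 (over p t tu tv Dp).
    rewrite invS // => /esym/eqP; rewrite oppr_eq0 => /eqP.
    by case: p Dp.
  have Suv p t tu tv : D p ->
      (zeta p * du h p + eta p * dv h p) * t
      + du (dv zeta) p * tu + du (dv eta) p * tv
      + dv zeta p * (a p * tu + b p * tv)
      + (du zeta p + dv eta p) * (h p * t)
      + du eta p * (a'' p * tu + b'' p * tv) = 0.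
    move=> Dp; have := prolong_system_uv openD szeta seta eqZ a b a'' b''
      smooth_h ord0 (over p t tu tv Dp).
    rewrite invS // => /esym/eqP; rewrite oppr_eq0 => /eqP.
    by case: p Dp.
  have Svv p t tu tv : D p ->
      (zeta p * du a'' p + eta p * dv a'' p - a'' p * du zeta p
        - b'' p * dv zeta p + dv (dv zeta) p) * tu
      + (zeta p * du b'' p + eta p * dv b'' p - a'' p * du eta p
        - b'' p * dv eta p + dv (dv eta) p) * tv
      + 2 * (dv zeta p * (h p * t) + dv eta p * (a'' p * tu + b'' p * tv)) = 0.
    move=> Dp; have := prolong_system_vv openD szeta seta eqZ a b h
      smooth_a'' smooth_b'' ord0 (over p t tu tv Dp).
    rewrite invS // => /esym/eqP; rewrite oppr_eq0 => /eqP.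
    by case: p Dp.
  have eta_u p : D p -> du eta p = 0.
    (* What remains is 2 eta_u h = 0, and h is nonzero. *)
    move=> Dp; have /eqP := Suu p 1 0 0 Dp.
    rewrite !(mulr0, add0r) mulr1 !mulf_eq0 pnatr_eq0 (negbTE (h_neq0 _ Dp)).
    by rewrite orbF => /eqP.
  have zeta_v p : D p -> dv zeta p = 0.
    move=> Dp; have /eqP := Svv p 1 0 0 Dp.
    rewrite !(mulr0, add0r, addr0) mulr1 !mulf_eq0 pnatr_eq0.
    by rewrite (negbTE (h_neq0 _ Dp)) orbF => /eqP.
  exists zeta, eta; split=> //.
  - exact/(function_of_uP openD szeta).
  - exact/(function_of_vP openD seta).
  move=> p Dp.
  have eta_uu : du (du eta) p = 0 by exact: derive0 eta_u Dp.
  have zeta_vv : dv (dv zeta) p = 0 by exact: derive0 zeta_v Dp.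
  split.
  (* With zeta_v = 0, the terms - a zeta_u and 2 a zeta_u combine to a zeta_u. The other equations
     arise likewise. *)
  - have := Suu p 0 1 0 Dp; rewrite (zeta_v _ Dp).
    do ?[move: (du _ p) => ?]; do ?[move: (dv _ p) => ?].
    by move=> E; rewrite -[RHS]E; ring.
  - have := Suu p 0 0 1 Dp; rewrite eta_uu (eta_u _ Dp).
    do ?[move: (du _ p) => ?]; do ?[move: (dv _ p) => ?].
    by move=> E; rewrite -[RHS]E; ring.
  - have := Suv p 1 0 0 Dp.
    do ?[move: (du _ p) => ?]; do ?[move: (dv _ p) => ?].
    by move=> E; rewrite -[RHS]E; ring.
  - have := Svv p 0 1 0 Dp; rewrite zeta_vv (zeta_v _ Dp).
    do ?[move: (du _ p) => ?]; do ?[move: (dv _ p) => ?].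
    by move=> E; rewrite -[RHS]E; ring.
  - have := Svv p 0 0 1 Dp; rewrite (eta_u _ Dp).
    do ?[move: (du _ p) => ?]; do ?[move: (dv _ p) => ?].
    by move=> E; rewrite -[RHS]E; ring.
move=> [zeta [eta [[szeta seta] eqZ zetau etav eqs]]].
split; last by exists zeta, eta.
have eta_u := (function_of_vP openD seta).1 etav.
have zeta_v := (function_of_uP openD szeta).1 zetau.
split; first exact/(smooth_base_vfieldP openD eqZ).
move=> w [Dw _] sol [k al].
have {}Dw : jets_over D w by [].
have := eqs _ Dw; set p := (w cu, w cv).
have Dp : D p by [].
have [eta_u0 zeta_v0] := (eta_u p Dp, zeta_v p Dp).
have eta_uu : du (du eta) p = 0 by exact: derive0 eta_u Dp.
have zeta_vv : dv (dv zeta) p = 0 by exact: derive0 zeta_v Dp.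
have zeta_uv : du (dv zeta) p = 0 by exact: derive0 zeta_v Dp.
(* Unlike [dv zeta], the inner derivative [dv eta] need not vanish, so this mixed derivative
   requires independence of u. *)
have eta_uv := du_dv_function_of_v openD seta etav Dp.
have /subr0_eq Wuu := sol (eq_uu, al).
have /subr0_eq Wuv := sol (eq_uv, al).
have /subr0_eq Wvv := sol (eq_vv, al).
case=> E1 E2 E3 E4 E5; rewrite /= -/p in Wuu Wuv Wvv.
case: k.
- rewrite (prolong_system_uu openD szeta seta eqZ) // Wuu Wuv -/p.
  rewrite eta_u0 zeta_v0 eta_uu; move: E1 E2 => {Wuu Wuv Wvv}.
  do ?[move: (du _ p) => ?]; do ?[move: (dv _ p) => ?] => E1 E2.
  (* On solutions the prolongation is minus the combination of [E1] and [E2] with weights theta_u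
     and theta_v. The uv equation uses [E3] with weight theta, and the vv equation uses [E4] and
     [E5]. *)
  have := congr2 (fun x y => x * w (cd al 1 0) + y * w (cd al 0 1)) E1 E2.
  by rewrite /= !mul0r addr0 => E; rewrite -[RHS]oppr0 -[X in _ = - X]E; ring.
- rewrite (prolong_system_uv openD szeta seta eqZ) // Wuv -/p.
  rewrite eta_u0 zeta_v0 zeta_uv eta_uv; move: E3 => {Wuu Wuv Wvv}.
  do ?[move: (du _ p) => ?]; do ?[move: (dv _ p) => ?] => E3.
  have := congr1 (fun x => x * w (cd al 0 0)) E3.
  by rewrite /= mul0r => E; rewrite -[RHS]oppr0 -[X in _ = - X]E; ring.
- rewrite (prolong_system_vv openD szeta seta eqZ) // Wvv Wuv -/p.
  rewrite eta_u0 zeta_v0 zeta_vv; move: E4 E5 => {Wuu Wuv Wvv}.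
  do ?[move: (du _ p) => ?]; do ?[move: (dv _ p) => ?] => E4 E5.
  have := congr2 (fun x y => x * w (cd al 1 0) + y * w (cd al 0 1)) E4 E5.
  by rewrite /= !mul0r addr0 => E; rewrite -[RHS]oppr0 -[X in _ = - X]E; ring.
Qed.
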